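(* $\gamma'(\infty)=\gamma(\infty)=1/2$.
   Context: Definition of $\gamma(\infty)$. Let $M,N\in\mathbb N$ with $N\ge 2M$, let $\lambda:E(K_N)\to\{1,2,3,\ldots\}$ be a labeling of the edges of the complete graph $K_N$ by positive integers, and let $\mathcal M$ be a matching in $K_N$ with $M$ edges. An edge $uv$ of $K_N$ is critical if there is an edge $e\in\mathcal M$ covering $u$ or $v$ (i.e. incident to $u$ or to $v$) with $\lambda(uv)<\lambda(e)$. Let $\gamma(\infty,M,N,\lambda,\mathcal M)$ be the number of critical edges divided by $\binom{2M}{2}$. Then $$\gamma(\infty)=\limsup_{M\to\infty}\ \max_{N\ge 2M}\ \max_{\lambda}\ \min_{\mathcal M}\ \gamma(\infty,M,N,\lambda,\mathcal M),$$ where $\lambda$ ranges over all such labelings and $\mathcal M$ over all matchings of size $M$ in $K_N$. Definition of $\gamma'(\infty)$. This is the special case of perfect matchings, $N=2M$: for a labeling $\lambda:E(K_N)\to\{1,2,3,\ldots\}$ and a perfect matching $\mathcal M$ of $K_N$, an edge $uv$ is critical if $\lambda(uv)$ is strictly less than the maximum of the labels of the two edges of $\mathcal M$ covering $u$ and $v$. Let $\gamma'(\infty,N,\lambda,\mathcal M)$ be the number of critical edges divided by $\binom N2$. Then $$\gamma'(\infty)=\limsup_{N\to\infty,\ N\text{ even}}\ \max_{\lambda}\ \min_{\mathcal M}\ \gamma'(\infty,N,\lambda,\mathcal M),$$ where $\mathcal M$ ranges over all perfect matchings of $K_N$. *)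

(* Defs.v *)
From mathcomp Require Import all_boot all_order all_algebra.
From mathcomp Require Import all_classical all_reals all_analysis.

Set Implicit Arguments.
Unset Strict Implicit.
Unset Printing Implicit Defensive.

Import Order.TTheory GRing.Theory Num.Theory.

(* Edges of the complete graph K_N: the two-element subsets of 'I_N. *)
Definition edges (N : nat) : {set {set 'I_N}} :=
  [set e : {set 'I_N} | #|e| == 2]%SET.

(* A labeling is a total function on {set 'I_N}; only its values on edges are
   constrained, and only these are ever used. *)
Definition positive_labeling (N : nat) (lam : {set 'I_N} -> nat) : Prop :=
  forall e, e \in edges N -> 0 < lam e.

Definition matching (N : nat) (MM : {set {set 'I_N}}) : bool :=
  (MM \subset edges N) && finset.trivIset MM.

Definition perfect_matching (N : nat) (MM : {set {set 'I_N}}) : bool :=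
  matching MM && (finset.cover MM == [set: 'I_N]%SET).

Definition critical_edges (N : nat) (lam : {set 'I_N} -> nat)
    (MM : {set {set 'I_N}}) : {set {set 'I_N}} :=
  [set f : {set 'I_N} in edges N |
    [exists e in MM, [exists u in f, u \in e] && (lam f < lam e)]]%SET.

(* For a perfect matching MM, pblock MM u is the edge of MM covering u. *)
Definition critical_edges' (N : nat) (lam : {set 'I_N} -> nat)
    (MM : {set {set 'I_N}}) : {set {set 'I_N}} :=
  [set f : {set 'I_N} in edges N |
    lam f < \max_(u in f) lam (finset.pblock MM u)]%SET.

Local Open Scope classical_set_scope.
Local Open Scope ring_scope.

Definition gamma_ratio (R : realType) (M N : nat) (lam : {set 'I_N} -> nat)
    (MM : {set {set 'I_N}}) : R :=
  #|critical_edges lam MM|%:R / 'C(M.*2, 2)%:R.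

Definition gamma'_ratio (R : realType) (N : nat) (lam : {set 'I_N} -> nat)
    (MM : {set {set 'I_N}}) : R :=
  #|critical_edges' lam MM|%:R / 'C(N, 2)%:R.

(* Maxima and minima are suprema and infima in \bar R. The infima range over
   finite sets of matchings, nonempty because M.*2 <= N (resp. N is even). The
   suprema range over infinite sets but are attained: choosing edges greedily by
   smallest label leaves at most 'C(M.*2, 2) critical edges, so the minima take
   finitely many values. *)
Definition min_gamma (R : realType) (M N : nat) (lam : {set 'I_N} -> nat)
    : \bar R :=
  ereal_inf [set (gamma_ratio R M lam MM)%:E |
              MM in [set MM | matching MM /\ #|MM| = M]].

Definition gamma_infty (R : realType) : \bar R :=
  limn_esup (fun M : nat =>
    ereal_sup [set ereal_sup [set min_gamma R M lam |
                               lam in [set lam | @positive_labeling N lam]] |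
                N in [set N | (M.*2 <= N)%N]]).

Definition min_gamma' (R : realType) (N : nat) (lam : {set 'I_N} -> nat)
    : \bar R :=
  ereal_inf [set (gamma'_ratio R lam MM)%:E |
              MM in [set MM | perfect_matching MM]].

(* The even numbers N are enumerated as N = n.*2. *)
Definition gamma'_infty (R : realType) : \bar R :=
  limn_esup (fun n : nat =>
    ereal_sup [set min_gamma' R lam |
                lam in [set lam | @positive_labeling n.*2 lam]]).

(* Main.v *)
Require Import Defs.
From mathcomp Require Import all_boot all_order all_algebra.
From mathcomp Require Import all_classical all_reals all_analysis.
From mathcomp Require Import zify lra.
(* Gives names such as [cover], [trivIset] and [subsetP] their finite meaning. *)
From mathcomp Require Import fintype boot.finset.


(** The maxima over labelings can be computed exactly: for every M both of them
    equal M (M - 1) / C(2M, 2), that is (M - 1) / (2M - 1) for M > 0, which tends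
    to 1/2. The matchings with M edges in K_(2M) are the perfect ones and for
    them the two notions of critical edge agree, so it suffices to bound the
    number of critical edges above for some matching, whatever the labeling and
    N >= 2M are, and below for every matching and one well chosen labeling.

    Fix a matching. An edge f joining two different matching edges e1 and e2 has
    a partner joining the other two ends, (e1 U e2) \ f ([switch]). There are
    2 M (M - 1) such cross edges, [switch] is an involution on them without fixed
    points, and f and its partner are critical against the same threshold,
    max (lambda e1) (lambda e2).

    Upper bound. Choose a matching of size M that minimizes the sum of
    (M + 1)^(lambda e) over its edges e. This weight grows so fast that no
    exchange can replace matching edges by edges all of whose labels lie below
    one of the labels removed ([bottleneck_optimal]). Replacing e by an edge with
    one end on e and the other uncovered shows that every critical edge is a
    cross edge ([optimal_critical_cross]). Replacing e1 and e2 by f and its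
    partner shows that these two are never both critical ([optimal_switch]). So
    at most half of the 2 M (M - 1) cross edges are critical.

    Lower bound. Label each edge by its smaller end. The least vertex of e1 U e2
    lies on f or on its partner, and that edge is critical, because the matching
    edge avoiding this vertex has a larger label ([first_label_switch]). So at
    least half of the cross edges are critical, for every matching. *)

Set Implicit Arguments.
Unset Strict Implicit.
Unset Printing Implicit Defensive.

Import Order.TTheory GRing.Theory Num.Theory numFieldNormedType.Exports.

Local Open Scope nat_scope.
Local Open Scope set_scope.

(** * Matchings, cross edges and their partners *)

Definition touched N (MM : {set {set 'I_N}}) (f : {set 'I_N}) :=
  [set e in MM | ~~ [disjoint e & f]].

(** When f joins two edges of the matching, this is the edge joining the two
    remaining ends. Removing f from the union of the edges it meets avoids naming
    the ends. *)
Definition switch N (MM : {set {set 'I_N}}) (f : {set 'I_N}) :=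
  cover (touched MM f) :\: f.

Definition cross_edges N (MM : {set {set 'I_N}}) : {set {set 'I_N}} :=
  [set f in edges N | (f \subset cover MM) && (f \notin MM)].

Lemma matching_card2 N (MM : {set {set 'I_N}}) e :
  matching MM -> e \in MM -> #|e| = 2.
Proof. by case/andP=> /subsetP sE _ /sE; rewrite inE => /eqP. Qed.

Lemma matching_sub N (MM B : {set {set 'I_N}}) :
  matching MM -> B \subset MM -> matching B.
Proof.
case/andP=> sE tI sB; rewrite /matching (subset_trans sB sE).
by apply/trivIsetP => e e' eB e'B; apply: (trivIsetP tI); apply: (subsetP sB).
Qed.

Lemma matching_meet N (MM : {set {set 'I_N}}) e e' x :
  matching MM -> e \in MM -> e' \in MM -> x \in e -> x \in e' -> e = e'.
Proof.
case/andP=> _ tI eM e'M xe xe'; apply/eqP/idPn => ne.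
by have /pred0P/(_ x) := trivIsetP tI e e' eM e'M ne; rewrite /= xe xe'.
Qed.

Lemma card_cover_matching N (MM : {set {set 'I_N}}) :
  matching MM -> #|cover MM| = #|MM|.*2.
Proof.
move=> mM; have /andP[_ /eqP <-] := mM.
rewrite (eq_bigr (fun _ => 2)); first by rewrite sum_nat_const muln2.
by move=> e; apply: matching_card2.
Qed.

Lemma matching_exists N M : M.*2 <= N ->
  exists2 MM : {set {set 'I_N}}, matching MM & #|MM| = M.
Proof.
elim: M => [|M IH] leN.
  exists set0; last by rewrite cards0.
  by rewrite /matching sub0set; apply/trivIsetP => e; rewrite inE.
have [|MM mM cM] := IH; first by lia.
have: 1 < #|~: cover MM|.
  by have := cardsC (cover MM); rewrite card_cover_matching // cM card_ord; lia.
case/card_gt1P=> x [y] []; rewrite !in_setC => xM yM nxy.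
have eN e : e \in MM -> [disjoint [set x; y] & e].
  move=> eM; rewrite disjoint_sym disjoints_subset; apply/subsetP => z ze.
  rewrite !inE negb_or; have zM : z \in cover MM by apply/bigcupP; exists e.
  by apply/andP; split; apply/eqP => zE; rewrite zE in zM;
    [move: xM | move: yM]; rewrite zM.
have nM : [set x; y] \notin MM.
  apply/negP => xyM; case/negP: xM.
  by apply/bigcupP; exists [set x; y]; rewrite ?set21.
exists ([set x; y] |: MM); last by rewrite cardsU1 nM cM.
case/andP: mM => sE tI; rewrite /matching subUset sub1set sE inE cards2 nxy /=.
apply/trivIsetP => e e'; rewrite !in_setU1.
case/predU1P=> [->|eM]; case/predU1P=> [->|e'M]; rewrite ?eqxx // => ne.
- exact: eN.
- by rewrite disjoint_sym eN.
- exact: (trivIsetP tI).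
Qed.

Lemma disjoint_coverD N (MM B : {set {set 'I_N}}) :
  matching MM -> B \subset MM -> [disjoint cover B & cover (MM :\: B)].
Proof.
move=> mM sB; apply/pred0P => x /=; apply/negP => /andP[].
case/bigcupP=> e eB xe /bigcupP[e']; rewrite inE => /andP[e'B e'M] xe'.
by rewrite -(matching_meet mM (subsetP sB _ eB) e'M xe xe') eB in e'B.
Qed.

Lemma touched_sub N (MM : {set {set 'I_N}}) (f : {set 'I_N}) :
  touched MM f \subset MM.
Proof. by apply/subsetP => e; rewrite inE => /andP[]. Qed.

(** The matching edges met by f are indexed by the covered vertices of f, so a
    bound on the latter bounds their number. *)
Lemma touchedE N (MM : {set {set 'I_N}}) (f : {set 'I_N}) :
  matching MM -> touched MM f = pblock MM @: (f :&: cover MM).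
Proof.
move=> mM; have /andP[_ tI] := mM; apply/setP => e; rewrite inE.
apply/andP/imsetP => [[eM]|[x]].
  case/pred0Pn=> x /andP[/= xe xf]; exists x; last by rewrite (def_pblock tI eM).
  by rewrite inE xf; apply/bigcupP; exists e.
rewrite inE => /andP[xf xM] ->; split; first exact: pblock_mem.
by apply/pred0Pn; exists x; rewrite /= mem_pblock xM.
Qed.

Lemma sub_cover_touched N (MM : {set {set 'I_N}}) (f : {set 'I_N}) :
  f \subset cover MM -> f \subset cover (touched MM f).
Proof.
move/subsetP=> sf; apply/subsetP => x xf; have /bigcupP[e eM xe] := sf x xf.
by apply/bigcupP; exists e => //; rewrite inE eM; apply/pred0Pn; exists x; apply/andP.
Qed.

Lemma card_touched_cross N (MM : {set {set 'I_N}}) (f : {set 'I_N}) :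
  matching MM -> f \in cross_edges MM -> #|touched MM f| = 2.
Proof.
move=> mM; rewrite !inE => /and3P[/eqP cf sf fM].
have /andP[_ tI] := mM.
rewrite (touchedE f mM) (setIidPl sf) -[RHS]cf; apply: card_in_imset => x y xf yf Exy.
apply/eqP; apply: contraNT fM => nxy.
have Ef : f = [set x; y].
  apply/esym/eqP; rewrite eqEcard cards2 nxy cf leqnn andbT.
  by apply/subsetP => z; rewrite !inE => /orP[]/eqP->.
have eM := pblock_mem (subsetP sf x xf).
suff -> : f = pblock MM x by [].
apply/eqP; rewrite eqEcard cf (matching_card2 mM eM) leqnn andbT Ef.
apply/subsetP => z; rewrite !inE => /orP[]/eqP->.
  by rewrite mem_pblock (subsetP sf).
by rewrite Exy mem_pblock (subsetP sf).
Qed.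

Lemma touched_switch_sub N (MM : {set {set 'I_N}}) (f : {set 'I_N}) :
  matching MM -> touched MM (switch MM f) \subset touched MM f.
Proof.
move=> mM; apply/subsetP => e; rewrite inE => /andP[eM /pred0Pn[x /andP[/= xe]]].
rewrite inE => /andP[_ /bigcupP[e' e't xe']].
by rewrite (matching_meet mM eM (subsetP (touched_sub _ _) _ e't) xe xe').
Qed.

(** If the partner of f were a matching edge, it would be one of the edges met by
    f, whereas it is disjoint from f. *)
Lemma switch_cross N (MM : {set {set 'I_N}}) (f : {set 'I_N}) :
  matching MM -> f \in cross_edges MM -> switch MM f \in cross_edges MM.
Proof.
move=> mM fX; have := fX; rewrite inE => /and3P[fE sf fM].
have c4 : #|cover (touched MM f)| = 4.
  rewrite card_cover_matching ?(matching_sub mM (touched_sub _ _)) //.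
  by rewrite card_touched_cross.
have c2 : #|switch MM f| = 2.
  rewrite /switch cardsD (setIidPr (sub_cover_touched sf)) c4.
  by move: fE; rewrite inE => /eqP->.
rewrite !inE c2 eqxx /=; apply/andP; split.
  apply/subsetP => x; rewrite inE => /andP[_ /bigcupP[e et xe]].
  by apply/bigcupP; exists e => //; apply: subsetP et; apply: touched_sub.
apply/negP => sM.
have : switch MM f \in touched MM f.
  apply: (subsetP (touched_switch_sub f mM)); rewrite inE sM /=.
  by rewrite -setI_eq0 setIid -card_gt0 c2.
by rewrite inE sM -setI_eq0 setIDAC setDIl setDv setI0 eqxx.
Qed.

(** An edge and its partner are critical against the same two matching edges. *)
Lemma touched_switch N (MM : {set {set 'I_N}}) (f : {set 'I_N}) :
  matching MM -> f \in cross_edges MM ->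
  touched MM (switch MM f) = touched MM f.
Proof.
move=> mM fX; apply/eqP; rewrite eqEcard touched_switch_sub //.
by rewrite !card_touched_cross ?switch_cross.
Qed.

Lemma switchK N (MM : {set {set 'I_N}}) :
  matching MM -> {in cross_edges MM, involutive (switch MM)}.
Proof.
move=> mM f fX; rewrite {1}/switch touched_switch // setDDr setDv set0U.
by apply/setIidPr/sub_cover_touched; move: fX; rewrite inE => /and3P[].
Qed.

(** Of the C(2M, 2) pairs of covered vertices, M are matching edges. *)
Lemma card_cross N (MM : {set {set 'I_N}}) :
  matching MM -> #|cross_edges MM| = (#|MM| * #|MM|.-1).*2.
Proof.
move=> mM; set D := [set f : {set 'I_N} | f \subset cover MM & #|f| == 2].
have cD : #|D| = 'C(#|MM|.*2, 2) by rewrite cards_draws card_cover_matching.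
have sD : MM \subset D.
  apply/subsetP => e eM; rewrite inE (matching_card2 mM eM) eqxx andbT.
  exact: (bigcup_sup e).
have -> : cross_edges MM = D :\: MM.
  by apply/setP => f; rewrite !inE andbA andbC [in RHS](andbC (f \subset _)).
rewrite cardsD (setIidPr sD) cD bin2 -doubleMl doubleK.
by case: #|MM| => [//|m]; rewrite /=; nia.
Qed.

Lemma criticalP N (lam : {set 'I_N} -> nat) (MM : {set {set 'I_N}})
    (f : {set 'I_N}) :
  reflect (f \in edges N /\ exists2 e, e \in touched MM f & lam f < lam e)
          (f \in critical_edges lam MM).
Proof.
rewrite [f \in critical_edges _ _]in_set; apply: (iffP andP) => -[fE].
  case/existsP=> e /andP[eM /andP[/existsP[u /andP[uf ue]] lt]]; split=> //.
  by exists e; rewrite // inE eM; apply/pred0Pn; exists u; apply/andP.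
case=> e; rewrite inE => /andP[eM /pred0Pn[u /andP[/= ue uf]]] lt; split=> //.
apply/existsP; exists e; rewrite eM lt andbT.
by apply/existsP; exists u; rewrite uf ue.
Qed.

(** * At most half of the cross edges are critical for an optimal matching *)

Definition bottleneck_optimal N (lam : {set 'I_N} -> nat) (MM : {set {set 'I_N}}) :=
  forall MM', matching MM' -> #|MM'| = #|MM| ->
  forall e, e \in MM :\: MM' -> exists2 f, f \in MM' :\: MM & lam e <= lam f.

(** With weight (M + 1)^(lambda e), a single edge outweighs any M edges of smaller
    labels, so a matching of least total weight has the property. *)
Lemma bottleneck_optimal_exists N M (lam : {set 'I_N} -> nat) : M.*2 <= N ->
  exists MM, [/\ matching MM, #|MM| = M & bottleneck_optimal lam MM].
Proof.
move=> leN; have [M0 m0 c0] := matching_exists leN.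
pose w (MM : {set {set 'I_N}}) := \sum_(e in MM) M.+1 ^ lam e.
pose P (MM : {set {set 'I_N}}) := matching MM && (#|MM| == M).
have P0 : P M0 by rewrite /P m0 c0 eqxx.
case: (arg_minnP w P0) => MM /andP[mM /eqP cM] minM.
exists MM; split=> // MM' mM' cM' e eM; apply/exists_inP; apply: contraT.
rewrite negb_exists_in => /forall_inP small.
have := minM MM'; rewrite /P mM' cM' cM eqxx leqNgt => /(_ isT)/negP[].
rewrite /w (big_setID MM) [X in _ < X](big_setID MM') /= setIC ltn_add2l.
rewrite [X in _ < X](bigD1 e) //= ltn_addr // -(@ltn_pmul2l M.+1) //.
have: \sum_(f in MM' :\: MM) M.+1 * M.+1 ^ lam f <= M * M.+1 ^ lam e.
  apply: leq_trans (_ : \sum_(f in MM' :\: MM) M.+1 ^ lam e <= _).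
    apply: leq_sum => f fM; rewrite -expnS leq_pexp2l //.
    by rewrite ltnNge small.
  rewrite sum_nat_const leq_mul2r -cM -cM'.
  by rewrite subset_leq_card ?orbT // subsetDl.
rewrite -big_distrr /= => /leq_ltn_trans; apply.
by rewrite ltn_mul2r expn_gt0 ltnSn.
Qed.

(** The form in which optimality is used: a part B of the matching can be replaced
    by any F of the same size that avoids the rest of the matching. *)
Lemma optimal_exchange N (lam : {set 'I_N} -> nat) (MM B F : {set {set 'I_N}})
    (e : {set 'I_N}) :
  matching MM -> bottleneck_optimal lam MM -> B \subset MM -> matching F ->
  #|F| = #|B| -> [disjoint cover F & cover (MM :\: B)] -> e \in B ->
  exists2 f, f \in F & lam e <= lam f.
Proof.
move=> mM opt sB mF cF dF eB; set MM' := F :|: (MM :\: B).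
have mD : matching (MM :\: B) by apply: matching_sub mM _; apply: subsetDl.
have dis f g : f \in F -> g \in MM :\: B -> [disjoint f & g].
  by move=> fF gD; apply: disjointWl (bigcup_sup f fF) (disjointWr (bigcup_sup g gD) dF).
have mM' : matching MM'.
  case/andP: (mF) (mD) => sF tF /andP[sD tD]; rewrite /matching subUset sF sD /=.
  apply/trivIsetP => f g; rewrite !(in_setU _ F).
  case/orP=> fM; case/orP=> gM ne.
  - exact: (trivIsetP tF).
  - exact: dis.
  - by rewrite disjoint_sym dis.
  - exact: (trivIsetP tD).
have dFD : F :&: (MM :\: B) = set0.
  apply/setP => f; rewrite in_set0; apply/negP; rewrite in_setI => /andP[fF fD].
  by have := dis f f fF fD; rewrite -setI_eq0 setIid -cards_eq0 (matching_card2 mF fF).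
have cM' : #|MM'| = #|MM|.
  by rewrite cardsU dFD cards0 subn0 cF -(cardsID B MM) (setIidPr sB).
have [eF|eF] := boolP (e \in F); first by exists e.
have [|f] := opt _ mM' cM' e.
  by rewrite !inE eB (negbTE eF) (subsetP sB).
rewrite !inE => /andP[fM /orP[fF|/andP[_]]]; last by rewrite (negbTE fM).
by exists f.
Qed.

Lemma touched_disjoint N (MM : {set {set 'I_N}}) (f : {set 'I_N}) :
  [disjoint f & cover (MM :\: touched MM f)].
Proof.
apply/pred0P => x /=; apply/negP => /andP[xf /bigcupP[e]].
rewrite inE => /andP[eN eM] xe; case/negP: eN.
by rewrite inE eM; apply/pred0Pn; exists x; rewrite /= xe.
Qed.

(** A critical edge with an uncovered end meets a single matching edge, of larger
    label, and could replace it. *)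
Lemma optimal_critical_cross N (lam : {set 'I_N} -> nat) (MM : {set {set 'I_N}}) :
  matching MM -> bottleneck_optimal lam MM ->
  critical_edges lam MM \subset cross_edges MM.
Proof.
move=> mM opt; apply/subsetP => f /criticalP[fE [e et lt]].
have cf : #|f| = 2 by move: fE; rewrite inE => /eqP.
rewrite inE fE /=; apply/andP; split; last first.
  apply: contraL lt => fM; move: et; rewrite inE => /andP[eM /pred0Pn[x /andP[/= xe xf]]].
  by rewrite (matching_meet mM eM fM xe xf) ltnn.
apply/idPn => sf.
have ct : #|touched MM f| = 1.
  have t0 : 0 < #|touched MM f| by apply/card_gt0P; exists e.
  apply/eqP; rewrite eqn_leq t0 andbT.
  rewrite touchedE //; apply: leq_trans (leq_imset_card _ _) _; rewrite -ltnS -cf.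
  apply: proper_card; rewrite properE subsetIl.
  by apply: contra sf => /subset_trans; apply; apply: subsetIr.
have [||||g] := @optimal_exchange N lam MM (touched MM f) [set f] e
  mM opt _ _ _ _ et.
- exact: touched_sub.
- rewrite /matching sub1set fE; apply/trivIsetP => x y.
  by rewrite !inE => /eqP-> /eqP->; rewrite eqxx.
- by rewrite cards1 ct.
- by rewrite /cover big_set1 touched_disjoint.
- by rewrite inE => /eqP->; rewrite leqNgt lt.
Qed.

(** If an edge and its partner were both critical, both labels would be below the
    larger of the two labels of the matching edges they meet, and the pair could
    replace these matching edges. *)
Lemma optimal_switch N (lam : {set 'I_N} -> nat) (MM : {set {set 'I_N}})
    (f : {set 'I_N}) :
  matching MM -> bottleneck_optimal lam MM ->
  f \in critical_edges lam MM -> switch MM f \notin critical_edges lam MM.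
Proof.
move=> mM opt fC; have fX := subsetP (optimal_critical_cross mM opt) f fC.
have sX := switch_cross mM fX.
apply/negP => /criticalP[gE [e' e't lt']].
case/criticalP: fC => fE [e et lt].
rewrite touched_switch // in e't.
have [e0 e0t [l0 l0']] : exists2 e0, e0 \in touched MM f &
    lam f < lam e0 /\ lam (switch MM f) < lam e0.
  case: (leqP (lam e) (lam e')) => h; [exists e' | exists e] => //.
    by rewrite lt' (leq_trans lt).
  by rewrite lt (leq_trans lt') // ltnW.
have sf : f \subset cover MM by move: fX; rewrite inE => /and3P[].
have dfs : [disjoint f & switch MM f].
  by rewrite -setI_eq0 /switch setDE setICA setICr setI0.
have nfs : f != switch MM f.
  apply: contraTneq dfs => <-; rewrite -setI_eq0 setIid -cards_eq0.
  by move: fE; rewrite inE => /eqP->.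
have [||||g] := @optimal_exchange N lam MM (touched MM f) [set f; switch MM f] e0
  mM opt _ _ _ _ e0t.
- exact: touched_sub.
- rewrite /matching subUset !sub1set fE gE; apply/trivIsetP => x y.
  rewrite !inE => /orP[]/eqP-> /orP[]/eqP->; rewrite ?eqxx // => _.
  by rewrite disjoint_sym.
- by rewrite cards2 nfs card_touched_cross.
- apply: disjointWl (disjoint_coverD mM (touched_sub MM f)).
  apply/bigcupsP => x; rewrite !inE => /orP[]/eqP->; last exact: subsetDl.
  exact: sub_cover_touched.
- by rewrite !inE => /orP[]/eqP->; rewrite leqNgt ?l0 ?l0'.
Qed.

Lemma optimal_card_critical N (lam : {set 'I_N} -> nat) (MM : {set {set 'I_N}}) :
  matching MM -> bottleneck_optimal lam MM ->
  #|critical_edges lam MM| <= #|MM| * #|MM|.-1.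
Proof.
move=> mM opt; have sX := optimal_critical_cross mM opt.
rewrite -leq_double -card_cross // -addnn -(cardsID (critical_edges lam MM) (cross_edges MM)).
rewrite (setIidPr sX) leq_add2l.
rewrite -(card_in_imset (f := switch MM)); last first.
  apply: (can_in_inj (g := switch MM)) => f fC; apply: switchK => //.
  exact: (subsetP sX).
apply/subset_leq_card/subsetP => _ /imsetP[f fC ->].
by rewrite inE optimal_switch // switch_cross // (subsetP sX).
Qed.

(** * At least half of the cross edges are critical for one labeling *)

(** For a nonempty e this is 1 + min e: the vertices below all elements of e are
    counted, and 1 is added to make labels positive. *)
Definition first_label N (e : {set 'I_N}) : nat :=
  #|[set i : 'I_N | [forall j in e, i < j]]|.+1.

Lemma first_label_lt N (f e : {set 'I_N}) a :
  a \in f -> (forall u, u \in e -> a < u) -> first_label f < first_label e.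
Proof.
move=> af ae; rewrite ltnS; apply: proper_card; apply/properP; split.
  apply/subsetP => i; rewrite !inE => /forall_inP/(_ a af) ia.
  by apply/forall_inP => u /ae; apply: ltn_trans.
exists a; first by rewrite inE; apply/forall_inP.
by rewrite inE; apply/negP => /forall_inP/(_ a af); rewrite ltnn.
Qed.

(** The matching edge met by f that avoids a has its vertices above a, hence a
    label larger than that of f. *)
Lemma first_label_critical N (MM : {set {set 'I_N}}) (f : {set 'I_N}) a :
  matching MM -> f \in cross_edges MM -> a \in f ->
  (forall u, u \in cover (touched MM f) -> a <= u) ->
  f \in critical_edges (@first_label N) MM.
Proof.
move=> mM fX af amin; apply/criticalP; split; first by move: fX; rewrite inE => /andP[].
have sf : f \subset cover MM by move: fX; rewrite inE => /and3P[].
have := card_touched_cross mM fX; rewrite (cardsD1 (pblock MM a)) => ct.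
have : 0 < #|touched MM f :\ pblock MM a|.
  by rewrite -(ltn_add2l (pblock MM a \in touched MM f)) ct addn0; case: (_ \in _).
case/card_gt0P=> e; rewrite in_setD1 => /andP[ne et]; exists e => //.
apply: first_label_lt af _ => u ue; rewrite ltn_neqAle amin ?andbT; last first.
  by apply/bigcupP; exists e.
apply: contra ne => /eqP/val_inj Eau; apply/eqP/esym.
have /andP[_ tI] := mM; apply: def_pblock => //; last by rewrite Eau.
exact: (subsetP (touched_sub MM f)).
Qed.

Lemma first_label_switch N (MM : {set {set 'I_N}}) (f : {set 'I_N}) :
  matching MM -> f \in cross_edges MM ->
  (f \in critical_edges (@first_label N) MM) ||
  (switch MM f \in critical_edges (@first_label N) MM).
Proof.
move=> mM fX; have := fX; rewrite inE => /and3P[fE sf _].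
have /card_gt0P[x xf] : 0 < #|f| by move: fE; rewrite inE => /eqP->.
have xC := subsetP (sub_cover_touched sf) x xf.
case: (arg_minnP (fun i : 'I_N => i : nat) xC) => a aC amin.
have [af|af] := boolP (a \in f).
  by rewrite (first_label_critical mM fX af).
apply/orP; right; apply: (first_label_critical (a := a)) => //.
- exact: switch_cross.
- by rewrite inE af.
- by rewrite touched_switch.
Qed.

Lemma first_label_card_critical N (MM : {set {set 'I_N}}) :
  matching MM -> #|MM| * #|MM|.-1 <= #|critical_edges (@first_label N) MM|.
Proof.
move=> mM; set C := critical_edges _ _.
rewrite -leq_double -card_cross // -addnn -(cardsID C (cross_edges MM)).
apply: leq_add; first exact: subset_leq_card (subsetIr _ _).
rewrite -(card_in_imset (f := switch MM)); last first.
  apply: (can_in_inj (g := switch MM)) => f fC; apply: switchK => //.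
  by move: fC; rewrite inE => /andP[].
apply/subset_leq_card/subsetP => _ /imsetP[f + ->].
rewrite inE => /andP[fC fX].
by have := first_label_switch mM fX; rewrite (negbTE fC).
Qed.

(** * The values of the extremal problems *)

Lemma perfect_matchingE n (MM : {set {set 'I_n.*2}}) :
  perfect_matching MM = matching MM && (#|MM| == n).
Proof.
rewrite /perfect_matching; apply: andb_id2l => mM.
rewrite eqEcard subsetT cardsT card_ord card_cover_matching //=.
have := max_card (cover MM); rewrite card_cover_matching // card_ord !leq_double => le.
by rewrite eqn_leq le.
Qed.

Lemma critical_edges'E N (lam : {set 'I_N} -> nat) (MM : {set {set 'I_N}}) :
  perfect_matching MM -> critical_edges' lam MM = critical_edges lam MM.
Proof.
case/andP=> mM /eqP cM; have /andP[_ tI] := mM.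
apply/setP => f; rewrite !inE; apply: andb_id2l => fE.
apply/idP/existsP => [|[e /andP[eM /andP[/existsP[u /andP[uf ue]] lt]]]]; last first.
  rewrite -(def_pblock tI eM ue) in lt; apply: leq_trans lt _.
  exact: (@leq_bigmax_cond _ _ (fun u => lam (pblock MM u)) u uf).
move=> lt; have [u uf ltu] : exists2 u, u \in f & lam f < lam (pblock MM u).
  apply/exists_inP; apply: contraTT lt; rewrite negb_exists_in -leqNgt => /forall_inP h.
  by apply/bigmax_leqP => u uf; rewrite leqNgt h.
have uM : u \in cover MM by rewrite cM inE.
exists (pblock MM u); rewrite pblock_mem //= ltu andbT; apply/existsP; exists u.
by rewrite uf mem_pblock uM.
Qed.

(** The common value of both maxima for matchings of size M. For M = 0 the
    denominator vanishes and the quotient is 0, as in [gamma_ratio]. *)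
Definition optimal_ratio (R : realType) (M : nat) : R :=
  ((M * M.-1)%N%:R / 'C(M.*2, 2)%:R)%R.

Lemma min_gamma_le (R : realType) M N (lam : {set 'I_N} -> nat) :
  M.*2 <= N -> (min_gamma R M lam <= (optimal_ratio R M)%:E)%E.
Proof.
move=> leN; have [MM [mM cM opt]] := bottleneck_optimal_exists lam leN.
apply: ge_ereal_inf; exists (gamma_ratio R M lam MM)%:E; first by exists MM.
rewrite lee_fin ler_wpM2r ?invr_ge0 ?ler0n // ler_nat -cM.
exact: optimal_card_critical.
Qed.

Lemma min_gamma_first_label (R : realType) M N :
  ((optimal_ratio R M)%:E <= min_gamma R M (@first_label N))%E.
Proof.
apply: le_ereal_inf_tmp => _ [MM [mM cM] <-].
rewrite lee_fin ler_wpM2r ?invr_ge0 ?ler0n // ler_nat -cM.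
exact: first_label_card_critical.
Qed.

(** Both problems agree on K_(2n), so the bounds for gamma also settle gamma'. *)
Lemma min_gamma'E (R : realType) n (lam : {set 'I_n.*2} -> nat) :
  min_gamma' R lam = min_gamma R n lam.
Proof.
congr ereal_inf; apply/seteqP; split=> r /= [MM] => [pM <-|].
  have := pM; rewrite perfect_matchingE => /andP[mM /eqP cM].
  by exists MM => //; rewrite /gamma'_ratio critical_edges'E.
case=> mM cM <-; have pM : perfect_matching MM by rewrite perfect_matchingE mM cM /=.
by exists MM => //; rewrite /gamma'_ratio critical_edges'E.
Qed.

Lemma sup_min_gamma (R : realType) M :
  ereal_sup [set ereal_sup [set min_gamma R M lam |
                             lam in [set lam | @positive_labeling N lam]] |
              N in [set N | M.*2 <= N]]%classic = (optimal_ratio R M)%:E.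
Proof.
apply/eqP; rewrite eq_le; apply/andP; split.
  apply: ge_ereal_sup => _ [N /= leN <-].
  by apply: ge_ereal_sup => _ [lam _ <-]; apply: min_gamma_le.
apply: le_ereal_sup_tmp; eexists; first by exists M.*2 => //=.
apply: le_ereal_sup_tmp; eexists; last exact: (@min_gamma_first_label R M M.*2).
by exists (@first_label M.*2).
Qed.

Lemma sup_min_gamma' (R : realType) n :
  ereal_sup [set min_gamma' R lam |
              lam in [set lam | @positive_labeling n.*2 lam]]%classic =
  (optimal_ratio R n)%:E.
Proof.
apply/eqP; rewrite eq_le; apply/andP; split.
  by apply: ge_ereal_sup => _ [lam _ <-]; rewrite min_gamma'E; apply: min_gamma_le.
apply: le_ereal_sup_tmp; eexists; last exact: (@min_gamma_first_label R n n.*2).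
by exists (@first_label n.*2) => //; apply: min_gamma'E.
Qed.

(** * The limit *)

Lemma optimal_ratioS (R : realType) m :
  (optimal_ratio R m.+1 = m%:R / (m.*2.+1)%:R)%R.
Proof.
rewrite /optimal_ratio; have -> : 'C(m.+1.*2, 2) = m.+1 * m.*2.+1.
  by rewrite bin2 -doubleMl doubleK /=.
by rewrite !natrM -mulf_div divff ?mul1r // pnatr_eq0.
Qed.

Lemma optimal_ratio_bounds (R : realType) n :
  (1 / 2 - n.+1%:R^-1 <= optimal_ratio R n.+1 <= 1 / 2)%R.
Proof.
rewrite optimal_ratioS.
have -> : (n.*2.+1%:R = n%:R + n%:R + 1 :> R)%R.
  by rewrite -(natr1 n.*2) -addnn natrD.
rewrite -(natr1 n); have := ler0n R n; move: (n%:R : R)%R => x x0.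
have p1 : (0 < x + x + 1 :> R)%R by lra.
have p2 : (0 < x + 1 :> R)%R by lra.
rewrite ler_pdivlMr // ler_pdivrMr //; apply/andP; split; last by lra.
rewrite mulrBl lerBlDr -lerBlDl [X in (_ <= X)%R]mulrC ler_pdivlMr //; nra.
Qed.

Lemma cvg_optimal_ratio (R : realType) :
  (optimal_ratio R @ \oo --> (1 / 2 : R))%classic%R.
Proof.
rewrite -cvg_shiftS.
apply: (@squeeze_cvgr _ _ _ _ (fun n => 1 / 2 - harmonic n)%R (cst (1 / 2)%R)).
- by apply: nearW => n; apply: optimal_ratio_bounds.
- rewrite -{2}[(1 / 2)%R]subr0; apply: cvgB; first exact: cvg_cst.
  exact: cvg_harmonic.
- exact: cvg_cst.
Qed.

Local Open Scope ring_scope.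

Theorem proposition7 (R : realType) :
  gamma'_infty R = gamma_infty R /\ gamma_infty R = (1 / 2 : R)%:E.
Proof.
rewrite /gamma'_infty /gamma_infty.
rewrite (funext (@sup_min_gamma' R)) (funext (@sup_min_gamma R)).
split=> //.
have cv : ((EFin \o optimal_ratio R) @ \oo --> (1 / 2 : R)%:E)%classic.
  by apply: cvg_EFin; [exact: nearW | exact: cvg_optimal_ratio].
by rewrite is_cvg_limn_esupE; [apply: cvg_lim cv | apply/cvg_ex; eexists; exact: cv].
Qed.
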